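(* Let $\Gamma$ be a Shilla distance-regular graph with $b(\Gamma)=b$ and smallest eigenvalue $\theta_3$. Then $\theta_3<-b^2+2$ if and only if $b=2$.
   Context: A connected graph $\Gamma$ of diameter $D$ is distance-regular if there are integers $b_i,c_i$ ($0\le i\le D$) such that for any two vertices $x,y$ at distance $i$, exactly $c_i$ neighbours of $y$ are at distance $i-1$ from $x$ and exactly $b_i$ neighbours of $y$ are at distance $i+1$ from $x$. Then $\Gamma$ is regular of valency $k=b_0$, and $a_i:=k-b_i-c_i$. Its eigenvalues (of the adjacency matrix) are $k=\theta_0>\theta_1>\dots>\theta_D$. A Shilla distance-regular graph is a distance-regular graph of diameter $3$ whose second largest eigenvalue satisfies $\theta_1=a_3$; for such graphs $k=(a_3-a_1)a_3$ and $b(\Gamma):=a_3-a_1=k/a_3$. *)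

(* Defs.v *)
From HB Require Import structures.
From mathcomp Require Import all_boot all_order all_algebra.
Set Implicit Arguments. Unset Strict Implicit. Unset Printing Implicit Defensive.
Import Order.TTheory GRing.Theory Num.Theory.

(* A simple graph: vertex set T (finite), adjacency relation e
   (assumed symmetric and irreflexive in the theorem). *)

Definition ball (T : finType) (e : rel T) (n : nat) (x : T) : {set T} :=
  iter n (fun S => S :|: [set y | [exists z in S, e z y]]) [set x].

(* graph distance: least n with y in ball n x (= #|T| if unreachable) *)
Definition dist (T : finType) (e : rel T) (x y : T) : nat :=
  find (fun n => y \in ball e n x) (iota 0 #|T|).

Definition connected_graph (T : finType) (e : rel T) : Prop :=
  forall x y : T, dist e x y < #|T|.

Definition has_diameter (T : finType) (e : rel T) (D : nat) : Prop :=
  (forall x y : T, dist e x y <= D) /\ (exists x y : T, dist e x y = D).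

Definition distance_regular (T : finType) (e : rel T) (D : nat)
    (b c : nat -> nat) : Prop :=
  connected_graph e /\ has_diameter e D /\
  forall i, i <= D -> forall x y : T, dist e x y = i ->
    #|[set z | e y z && (dist e x z == i.-1)]| = (if i == 0 then 0 else c i) /\
    #|[set z | e y z && (dist e x z == i.+1)]| = b i.

Definition aparam (b c : nat -> nat) (i : nat) : nat := b 0 - b i - c i.

Local Open Scope ring_scope.

Definition adjmx (R : nzRingType) (T : finType) (e : rel T) : 'M[R]_#|T| :=
  \matrix_(i, j) (e (enum_val i) (enum_val j))%:R.

Definition is_eigenvalue (R : fieldType) (T : finType) (e : rel T) (t : R) :=
  eigenvalue (adjmx R e) t.

Definition second_largest_eigenvalue (R : numFieldType) (T : finType)
    (e : rel T) (t : R) : Prop :=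
  is_eigenvalue e t /\
  exists t0 : R, [/\ is_eigenvalue e t0, t < t0,
    (forall mu, is_eigenvalue e mu -> mu <= t0) &
    (forall mu, is_eigenvalue e mu -> mu < t0 -> mu <= t)].

Definition smallest_eigenvalue (R : numFieldType) (T : finType)
    (e : rel T) (t : R) : Prop :=
  is_eigenvalue e t /\ forall mu, is_eigenvalue e mu -> t <= mu.

Definition shilla (R : numFieldType) (T : finType) (e : rel T)
    (b c : nat -> nat) : Prop :=
  distance_regular e 3 b c /\
  second_largest_eigenvalue e ((aparam b c 3)%:R : R).

(* Main.v *)
Require Import Defs.
From HB Require Import structures.
From mathcomp Require Import all_boot all_order all_algebra.
From mathcomp Require Import zify ring lra.
Import Order.TTheory GRing.Theory Num.Theory.
Local Open Scope ring_scope.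

(* Write a = a_3 and s = - theta_3. Since a is an eigenvalue, k = a b,
   b_1 = (a + 1)(b - 1), c_3 = a (b - 1), and theta_2, theta_3 are the roots of
   f(z) = z^2 + (b + b_2 + c_2 - a) z + b b_2 + c_2 - a b. As f(-b) < 0, always
   theta_3 < -b, which settles b = 2.

   Let b >= 3 and suppose s > b^2 - 2. The Krein condition q^3_11 >= 0 reads
   c_2 (s - b) <= (b^2 - s) b_2, so s < b^2 and a is large compared with c_2.
   - If theta_2 and theta_3 have equal multiplicities, comparing the two
     multiplicity formulas gives, with d = 2 b + theta_2 + theta_3 an integer,
     d (a b + b - d)(a + b - d) = (b - 1) c_2 (2 (b + 1) a + 4 b - 3 d).
     Size forces d = 1 and b <= 4; a divisibility argument excludes these cases.
   - Otherwise theta_3 is rational, hence an integer, hence s = b^2 - 1. A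
     coclique of size b + 1 in the local graph gives
     2 a + 2 - b^2 + b <= b (b + 1) c_2, which contradicts the Krein condition,
     except for b = 3, where finitely many parameters remain and all have a
     nonintegral multiplicity. *)

Set Implicit Arguments.
Unset Strict Implicit.

(** * Distance in a connected graph *)

Section Distance.
Variables (T : finType) (e : rel T).
Local Open Scope nat_scope.

Lemma mem_ballS n x y :
  (y \in ball e n.+1 x) = (y \in ball e n x) || [exists z in ball e n x, e z y].
Proof. by rewrite /ball /= !inE. Qed.

Lemma ball_mono m n x : m <= n -> ball e m x \subset ball e n x.
Proof.
move=> /subnKC <-; elim: (n - m) => [|d IH]; first by rewrite addn0.
by rewrite addnS; apply: (subset_trans IH); apply/subsetP => y; rewrite mem_ballS => ->.
Qed.

Lemma ball_trans m n x y z :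
  y \in ball e m x -> z \in ball e n y -> z \in ball e (m + n) x.
Proof.
move=> xy; elim: n z => [|n IH] z; first by rewrite addn0 /ball /= inE => /eqP ->.
rewrite addnS !mem_ballS => /orP[/IH -> //|/existsP[w /andP[/IH xw wz]]].
by apply/orP; right; apply/existsP; exists w; rewrite xw.
Qed.

Hypothesis conn : connected_graph e.

Lemma mem_ball n x y : (y \in ball e n x) = (dist e x y <= n).
Proof.
have lt := conn x y.
have dP : y \in ball e (dist e x y) x.
  (* Connectivity makes [find] stop inside the list, so the distance is attained. *)
  have hs : has (fun n => y \in ball e n x) (iota 0 #|T|) by rewrite has_find size_iota.
  by have := nth_find 0 hs; rewrite nth_iota.
apply/idP/idP => [yb|/ball_mono/subsetP/(_ _ dP) //].
rewrite leqNgt; apply/negP => nlt.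
by have := before_find 0 nlt; rewrite nth_iota ?add0n ?yb //; apply: ltn_trans nlt lt.
Qed.

Lemma dist_eq0 x y : (dist e x y == 0) = (x == y).
Proof. by rewrite -leqn0 -mem_ball /ball /= inE eq_sym. Qed.

Lemma dist_leS n x y :
  (dist e x y <= n.+1) = (dist e x y <= n) || [exists z, (dist e x z <= n) && e z y].
Proof.
by rewrite -!mem_ball mem_ballS; congr (_ || _); apply: eq_existsb => z; rewrite mem_ball.
Qed.

Lemma dist_edge x y z : e y z -> dist e x z <= (dist e x y).+1.
Proof.
move=> yz; rewrite dist_leS; apply/orP; right.
by apply/existsP; exists y; rewrite leqnn.
Qed.

Lemma dist_pred n x y : dist e x y = n.+1 -> exists2 z, dist e x z = n & e z y.
Proof.
move=> xy; have := leqnn (dist e x y); rewrite {2}xy dist_leS xy ltnn /=.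
case/existsP => z /andP[xz zy]; exists z => //.
by have := dist_edge x zy; lia.
Qed.

Hypotheses (e_sym : symmetric e) (e_irr : irreflexive e).

Lemma dist_le_sym n x y : dist e x y <= n -> dist e y x <= n.
Proof.
elim: n y => [|n IH] y; first by rewrite !leqn0 !dist_eq0 eq_sym.
rewrite dist_leS => /orP[/IH/leqW //|/existsP[z /andP[/IH xz zy]]].
rewrite -mem_ball -add1n; apply: (@ball_trans _ _ _ z); last by rewrite mem_ball.
rewrite mem_ball dist_leS; apply/orP; right; apply/existsP; exists y.
by rewrite e_sym zy leqn0 dist_eq0 eqxx.
Qed.

Lemma distC x y : dist e x y = dist e y x.
Proof. by apply/eqP; rewrite eqn_leq; apply/andP; split; apply: dist_le_sym. Qed.

Lemma dist_eq1 x y : (dist e x y == 1) = e x y.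
Proof.
apply/eqP/idP => [/dist_pred[z /eqP]|xy]; first by rewrite dist_eq0 => /eqP <-.
have := dist_edge x xy; have /eqP -> : dist e x x == 0 by rewrite dist_eq0.
case: (posnP (dist e x y)) => [/eqP|]; last by lia.
by rewrite dist_eq0 => /eqP exy; rewrite exy e_irr in xy.
Qed.

End Distance.

(** * Distance matrices and spectrum *)

Section IntersectionNumbers.
Variables (T : finType) (e : rel T) (b c : nat -> nat).
Hypotheses (e_sym : symmetric e) (e_irr : irreflexive e).
Hypothesis dr : distance_regular e 3 b c.
Local Open Scope nat_scope.

Let conn : connected_graph e. Proof. by case: dr. Qed.

Lemma dist_le3 x y : dist e x y <= 3.
Proof. by case: dr => _ [[H _] _]. Qed.

Lemma card_closer x y :
  #|[set z | e y z && (dist e x z == (dist e x y).-1)]|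
    = if dist e x y == 0 then 0 else c (dist e x y).
Proof. by case: dr => _ [_ H]; case: (H _ (dist_le3 x y) x y erefl). Qed.

Lemma card_farther x y :
  #|[set z | e y z && (dist e x z == (dist e x y).+1)]| = b (dist e x y).
Proof. by case: dr => _ [_ H]; case: (H _ (dist_le3 x y) x y erefl). Qed.

Lemma card_nbrs y : #|[set z | e y z]| = b 0.
Proof.
have /eqP d0 : dist e y y == 0 by rewrite (dist_eq0 conn).
have := card_farther y y; rewrite d0 => <-; apply: eq_card => z.
by rewrite !inE (dist_eq1 conn) // andbb.
Qed.

Lemma dist_nbr x y z : e y z ->
  [|| dist e x z == (dist e x y).-1, dist e x z == dist e x y
    | dist e x z == (dist e x y).+1].
Proof.
move=> yz; have := dist_edge conn x yz.
have := dist_edge conn x (_ : e z y); rewrite e_sym => /(_ yz); lia.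
Qed.

(** A geodesic of length 3; it supplies the pairs on which the intersection numbers are evaluated
    below. *)
Lemma diameter_chain : exists x0 x1 x2 x3, [/\ dist e x0 x1 = 1, dist e x0 x2 = 2,
  dist e x0 x3 = 3, e x1 x2 & e x2 x3].
Proof.
case: dr => _ [[_ [x [y xy]]] _].
have [z xz zy] := dist_pred conn xy.
have [w xw wz] := dist_pred conn xz.
by exists x, w, z, y.
Qed.

Lemma c1E : c 1 = 1.
Proof.
have [x [y [_ [_ [xy _ _ _ _]]]]] := diameter_chain.
have := card_closer x y; rewrite xy /= => <-.
transitivity #|[set x]|; last by rewrite cards1.
apply: eq_card => z; rewrite !inE (dist_eq0 conn) eq_sym.
apply/andP/eqP => [[_ /eqP //]|->]; split => //.
by rewrite e_sym -(dist_eq1 conn) // xy.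
Qed.

Lemma b3E : b 3 = 0.
Proof.
have [x [_ [_ [y [_ _ xy _ _]]]]] := diameter_chain.
have := card_farther x y; rewrite xy => <-.
apply/eqP; rewrite cards_eq0; apply/eqP/setP => z; rewrite !inE.
by apply/negP => /andP[_ /eqP xz]; have := dist_le3 x z; rewrite xz.
Qed.

Lemma c2_gt0 : 0 < c 2.
Proof.
have [x [y [z [_ [xy xz _ yz _]]]]] := diameter_chain.
have := card_closer x z; rewrite xz /= => <-.
by apply/card_gt0P; exists y; rewrite inE e_sym yz xy.
Qed.

Lemma b1_gt0 : 0 < b 1.
Proof.
have [x [y [z [_ [xy xz _ yz _]]]]] := diameter_chain.
have := card_farther x y; rewrite xy /= => <-.
by apply/card_gt0P; exists z; rewrite inE yz xz.
Qed.

Lemma b2_gt0 : 0 < b 2.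
Proof.
have [x [_ [y [z [_ xy xz _ yz]]]]] := diameter_chain.
have := card_farther x y; rewrite xy /= => <-.
by apply/card_gt0P; exists z; rewrite inE yz xz.
Qed.

Lemma c3_leq : c 3 <= b 0.
Proof.
have [x [_ [_ [y [_ _ xy _ _]]]]] := diameter_chain.
have := card_closer x y; rewrite xy /= => <-; rewrite -(card_nbrs y).
by apply/subset_leq_card/subsetP => z; rewrite !inE => /andP[].
Qed.

Lemma c3_gt0 : 0 < c 3.
Proof.
have [x [_ [y [z [_ xy xz _ yz]]]]] := diameter_chain.
have := card_closer x z; rewrite xz /= => <-.
by apply/card_gt0P; exists y; rewrite inE e_sym yz xy.
Qed.

Lemma b1_ltn : b 1 < b 0.
Proof.
have [x [y [_ [_ [xy _ _ _ _]]]]] := diameter_chain.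
have := card_farther x y; rewrite xy /= => <-; rewrite -(card_nbrs y).
apply/proper_card/properP; split.
  by apply/subsetP => z; rewrite !inE => /andP[].
have /eqP xx : dist e x x == 0 by rewrite (dist_eq0 conn).
by exists x; rewrite !inE ?xx ?andbF // e_sym -(dist_eq1 conn) // xy.
Qed.

Section Matrices.
Variable R : numFieldType.
Local Open Scope ring_scope.

(* [distance_regular] leaves [c 0] unconstrained, hence the explicit [0]. *)
Definition dist_shift (u : nat -> R) (i : nat) : R :=
  (b 0)%:R * u i + (if i == 0%N then 0 else (c i)%:R) * (u i.-1 - u i)
    + (b i)%:R * (u i.+1 - u i).

Lemma sum_nbrs (u : nat -> R) x y :
  \sum_(z | e y z) u (dist e x z) = dist_shift u (dist e x y).
Proof.
set i := dist e x y.
(* Measuring from the baseline [u i] avoids counting the neighbours at distance [i]. For [i = 0] the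
   middle term vanishes because [i.-1 = i]. *)
transitivity (\sum_(z | e y z) (u i + (dist e x z == i.-1)%:R * (u i.-1 - u i)
                + (dist e x z == i.+1)%:R * (u i.+1 - u i))).
  apply: eq_bigr => z yz; have := dist_nbr x yz; rewrite -/i.
  have j1 (j : nat) : (j == j.+1) = false by rewrite ltn_eqF.
  have j2 (j : nat) : (j == j.+2) = false by rewrite ltn_eqF.
  case: (i) => [|j] /= /or3P[] /eqP ->; rewrite ?eqxx ?eqSS ?j1 ?j2 ?[_.+1 == _]gtn_eqF //=; ring.
rewrite !big_split /= -!mulr_suml /dist_shift -/i; congr (_ + _ * _ + _ * _).
- by rewrite sumr_const -(card_nbrs y) cardsE mulr_natl.
- rewrite (_ : (if _ then _ else _) = (if i == 0%N then 0%N else c i)%:R); last by case: ifP.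
  rewrite -card_closer -/i -sum1_card natr_sum big_mkcond [RHS]big_mkcond /=.
  by apply: eq_bigr => z _; rewrite inE; case: (e y z) => //=; case: (_ == _).
- rewrite -card_farther -/i -sum1_card natr_sum big_mkcond [RHS]big_mkcond /=.
  by apply: eq_bigr => z _; rewrite inE; case: (e y z) => //=; case: (_ == _).
Qed.

(** A general element of the Bose-Mesner algebra: [u i] is the coefficient of the distance-[i]
    matrix. *)
Definition dist_mx (u : nat -> R) : 'M[R]_#|T| :=
  \matrix_(i, j) u (dist e (enum_val i) (enum_val j)).

Lemma sum_enum_val (F : T -> R) : \sum_(i < #|T|) F (enum_val i) = \sum_x F x.
Proof.
rewrite [RHS](reindex_onto (@enum_val T predT) enum_rank) => [|? _]; rewrite ?enum_rankK //.
by apply: eq_bigl => i; rewrite enum_valK eqxx.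
Qed.

Lemma eq_dist_mx (u v : nat -> R) :
  u 0%N = v 0%N -> u 1%N = v 1%N -> u 2 = v 2 -> u 3 = v 3 -> dist_mx u = dist_mx v.
Proof.
move=> h0 h1 h2 h3; apply/matrixP => i j; rewrite !mxE.
by move: (dist_le3 (enum_val i) (enum_val j)); case: (dist e _ _) => [|[|[|[|]]]].
Qed.

Lemma tr_dist_mx u : (dist_mx u)^T = dist_mx u.
Proof. by apply/matrixP => i j; rewrite !mxE distC. Qed.

Lemma adj_dist_mx u : adjmx R e *m dist_mx u = dist_mx (dist_shift u).
Proof.
apply/matrixP => i j; rewrite !mxE.
transitivity (\sum_(z | e (enum_val i) z) u (dist e (enum_val j) z)).
  rewrite [RHS]big_mkcond -sum_enum_val; apply: eq_bigr => l _; rewrite !mxE.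
  by rewrite (distC conn e_sym); case: (e _ _); rewrite ?mul1r ?mul0r.
by rewrite sum_nbrs (distC conn e_sym).
Qed.

Definition dlt (d i : nat) : R := (i == d)%:R.

Lemma adjmxE : adjmx R e = dist_mx (dlt 1).
Proof. by apply/matrixP => i j; rewrite !mxE /dlt (dist_eq1 conn). Qed.

Lemma dist_mx0 : dist_mx (dlt 0) = 1%:M.
Proof.
by apply/matrixP => i j; rewrite !mxE /dlt (dist_eq0 conn) (inj_eq enum_val_inj).
Qed.

End Matrices.
End IntersectionNumbers.

(** A full-rank factorization [E = C *m W] turns idempotence into [W *m C = 1], whose trace is the
    rank. *)
Lemma mxtrace_idem (F : fieldType) n (E : 'M[F]_n) :
  E *m E = E -> \tr E = (\rank E)%:R.
Proof.
have /row_fullP[L LC] := col_base_full E; have /row_freeP[Q RQ] := row_base_free E.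
move: (mulmx_base E) L LC Q RQ; move: (row_base E); move: (col_base E).
move: (\rank E) => r C W <- L LC Q RQ EE.
suff WC : W *m C = 1%:M by rewrite mxtrace_mulC WC mxtrace1.
have := congr1 (fun X => L *m X *m Q) EE.
by rewrite /= !mulmxA LC !mul1mx -!mulmxA RQ !mulmx1.
Qed.

(* [mu * U i j = \sum_p U i p * U j p] turns the sum into a sum of squares; for the
   eigenprojections this is the nonnegativity of the Krein parameters. *)
Lemma hadamard_psd (F : realFieldType) n (U V : 'M[F]_n) (mu nu : F) :
  U^T = U -> V^T = V -> U *m U = mu *: U -> V *m V = nu *: V -> 0 < mu -> 0 < nu ->
  0 <= \sum_i \sum_j U i j ^+ 2 * V i j.
Proof.
move=> Us Vs UU VV mu0 nu0.
have sq (W : 'M[F]_n) w i j : W^T = W -> W *m W = w *: W ->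
    w * W i j = \sum_p W i p * W j p.
  move=> Ws WW; have := congr1 (fun X : 'M_n => X i j) WW; rewrite !mxE => <-.
  by apply: eq_bigr => p _; rewrite -{2}Ws mxE.
rewrite -(pmulr_rge0 _ (mulr_gt0 (mulr_gt0 mu0 mu0) nu0)).
suff -> : mu * mu * nu * (\sum_i \sum_j U i j ^+ 2 * V i j) =
    \sum_p \sum_q \sum_r (\sum_i U i p * U i q * V i r) ^+ 2.
  by do 3!(apply: sumr_ge0 => ? _); apply: sqr_ge0.
transitivity (\sum_i \sum_j \sum_p \sum_q \sum_r
    (U i p * U i q * V i r) * (U j p * U j q * V j r)).
  rewrite mulr_sumr; apply: eq_bigr => i _; rewrite mulr_sumr; apply: eq_bigr => j _.
  transitivity ((mu * U i j) * (mu * U i j) * (nu * V i j)); first by ring.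
  rewrite (sq U) // (sq V) // mulr_suml mulr_suml; apply: eq_bigr => p _.
  rewrite -mulrA mulr_suml mulr_sumr; apply: eq_bigr => q _.
  rewrite !mulr_sumr; apply: eq_bigr => r _; ring.
under eq_bigr => i _ do rewrite exchange_big.
rewrite exchange_big; apply: eq_bigr => p _ /=.
under eq_bigr => i _ do rewrite exchange_big.
rewrite exchange_big; apply: eq_bigr => q _ /=.
under eq_bigr => i _ do rewrite exchange_big.
rewrite exchange_big; apply: eq_bigr => r _ /=.
rewrite expr2 mulr_suml; apply: eq_bigr => i _; by rewrite mulr_sumr.
Qed.

(** * Eigenvalues, multiplicities and Krein parameters *)

Section Spectrum.
Variables (R : rcfType) (T : finType) (e : rel T) (b c : nat -> nat).
Hypotheses (e_sym : symmetric e) (e_irr : irreflexive e).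
Hypothesis dr : distance_regular e 3 b c.

Local Notation k := ((b 0)%:R : R).
Local Notation A := (adjmx R e).
Local Notation D := (@dist_mx T e R).
Local Notation dl := (@dlt R).

(* Eigenvalues of the distance-2 and distance-3 matrices on a [t]-eigenvector of [A]. *)
Definition eigen2 (t : R) : R := (t ^+ 2 - (k - 1 - (b 1)%:R) * t - k) / (c 2)%:R.
Definition eigen3 (t : R) : R :=
  ((t - (k - (b 2)%:R - (c 2)%:R)) * eigen2 t - (b 1)%:R * t) / (c 3)%:R.

Let c2n0 : (c 2)%:R != 0 :> R. Proof. by rewrite pnatr_eq0 -lt0n (c2_gt0 e_sym dr). Qed.
Let c3n0 : (c 3)%:R != 0 :> R. Proof. by rewrite pnatr_eq0 -lt0n (c3_gt0 e_sym dr). Qed.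

Lemma dist_mxE (u : nat -> R) :
  D u = u 0%N *: 1%:M + u 1%N *: A + u 2 *: D (dl 2) + u 3 *: D (dl 3).
Proof.
rewrite -(dist_mx0 dr R) (adjmxE e_irr dr).
apply/matrixP => i j; rewrite !mxE /dlt.
move: (dist_le3 dr (enum_val i) (enum_val j)).
by case: (dist e _ _) => [|[|[|[|]]]] //= _; rewrite !mulr0 !mulr1 ?addr0 ?add0r.
Qed.

Lemma adj_mul1 : A *m A = k *: 1%:M + (k - 1 - (b 1)%:R) *: A + (c 2)%:R *: D (dl 2).
Proof.
rewrite {2}(adjmxE e_irr dr) (adj_dist_mx e_sym e_irr dr) dist_mxE.
rewrite /dist_shift /dlt /= (c1E e_sym e_irr dr).
rewrite [X in _ + X](_ : _ = 0); last by rewrite !subrr !mulr0 !addr0 scale0r.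
by rewrite addr0; congr (_ *: _ + _ *: _ + _ *: _); ring.
Qed.

Lemma adj_mul2 : A *m D (dl 2) =
  (b 1)%:R *: A + (k - (b 2)%:R - (c 2)%:R) *: D (dl 2) + (c 3)%:R *: D (dl 3).
Proof.
rewrite (adj_dist_mx e_sym e_irr dr) dist_mxE /dist_shift /dlt /=.
rewrite [X in X *: 1%:M](_ : _ = 0); last by ring.
by rewrite scale0r add0r; congr (_ *: _ + _ *: _ + _ *: _); ring.
Qed.

Lemma adj_mul3 : A *m D (dl 3) = (b 2)%:R *: D (dl 2) + (k - (c 3)%:R) *: D (dl 3).
Proof.
rewrite (adj_dist_mx e_sym e_irr dr) dist_mxE /dist_shift /dlt /=.
rewrite (b3E dr).
rewrite [X in X *: 1%:M](_ : _ = 0); last by ring.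
rewrite [X in X *: A](_ : _ = 0); last by ring.
by rewrite !scale0r !add0r; congr (_ *: _ + _ *: _); ring.
Qed.

Section LeftEigen.
Variables (m : nat) (B : 'M[R]_(m, #|T|)) (t : R).
Hypothesis BA : B *m A = t *: B.

(** [adj_mul1] is solved for the distance-2 matrix. [B] may have any number of rows, so it can be an
    eigenvector or a whole matrix [D u]. *)
Lemma mulmx_dist2 : B *m D (dl 2) = eigen2 t *: B.
Proof.
apply: (scalerI c2n0).
have := congr1 (mulmx B) adj_mul1.
rewrite mulmxA BA -scalemxAl BA !mulmxDr -!scalemxAr mulmx1 BA !scalerA.
rewrite (_ : (c 2)%:R * eigen2 t = t ^+ 2 - (k - 1 - (b 1)%:R) * t - k); last first.
  by rewrite /eigen2 mulrC divfK.
move/eqP; rewrite addrC -subr_eq => /eqP <-.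
by rewrite opprD addrA -!scalerBl addrAC.
Qed.

Lemma mulmx_dist3 : B *m D (dl 3) = eigen3 t *: B.
Proof.
apply: (scalerI c3n0).
have := congr1 (mulmx B) adj_mul2.
rewrite mulmxA BA -scalemxAl mulmx_dist2 !mulmxDr -!scalemxAr mulmx_dist2 BA !scalerA.
rewrite (_ : (c 3)%:R * eigen3 t =
    (t - (k - (b 2)%:R - (c 2)%:R)) * eigen2 t - (b 1)%:R * t); last first.
  by rewrite /eigen3 mulrC divfK.
move/eqP; rewrite addrC -subr_eq => /eqP <-.
rewrite -scalerDl -scalerBl; congr (_ *: _); ring.
Qed.

Lemma mulmx_dist (u : nat -> R) :
  B *m D u = (u 0%N + u 1%N * t + u 2 * eigen2 t + u 3 * eigen3 t) *: B.
Proof.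
rewrite dist_mxE !mulmxDr -!scalemxAr mulmx1 BA mulmx_dist2 mulmx_dist3 !scalerA.
by rewrite !scalerDl.
Qed.

(** There is no distance 4, so [adj_mul3] closes the recurrence and gives an equation of degree 4 in
    [t]. *)
Lemma eigen_quartic : B != 0 ->
  (t - (k - (c 3)%:R)) * eigen3 t = (b 2)%:R * eigen2 t.
Proof.
move=> B0; have := congr1 (mulmx B) adj_mul3.
rewrite mulmxA BA -scalemxAl mulmx_dist3 !mulmxDr -!scalemxAr mulmx_dist2 mulmx_dist3.
rewrite !scalerA => /eqP; rewrite -subr_eq0 -scalerDl -scalerBl scaler_eq0 (negPf B0) orbF.
by rewrite subr_eq0 => /eqP h; rewrite mulrBl h addrK.
Qed.

End LeftEigen.

(** The all-ones vector is an eigenvector for [k]; thus [eigen2 k] and [eigen3 k] count the vertices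
    at distance 2 and 3. *)
Lemma sum_dist (u : nat -> R) x :
  \sum_y u (dist e x y) = u 0%N + u 1%N * k + u 2 * eigen2 k + u 3 * eigen3 k.
Proof.
pose B : 'rV[R]_#|T| := const_mx 1.
have BA : B *m A = k *: B.
  apply/rowP => j; rewrite !mxE mulr1.
  have := card_nbrs e_irr dr (enum_val j) => <-.
  rewrite -sum1_card natr_sum [RHS]big_mkcond -[RHS]sum_enum_val.
  by apply: eq_bigr => i _; rewrite !mxE mul1r inE e_sym; case: (e _ _).
have := congr1 (fun X : 'rV_#|T| => X ord0 (enum_rank x)) (mulmx_dist BA u).
rewrite !mxE mulr1 => <-; rewrite -[LHS]sum_enum_val; apply: eq_bigr => i _.
by rewrite !mxE mul1r enum_rankK (distC _ e_sym) //; case: dr.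
Qed.

Lemma card_verts : #|T|%:R = 1 + k + eigen2 k + eigen3 k.
Proof.
have [x _] := diameter_chain dr.
by rewrite -sum1_card natr_sum (sum_dist (fun=> 1) x) !mul1r.
Qed.

Section RightEigen.
Variables (u : nat -> R) (t : R).
Hypotheses (h0 : k * u 1%N = t * u 0%N)
  (h1 : u 0%N + (k - 1 - (b 1)%:R) * u 1%N + (b 1)%:R * u 2 = t * u 1%N)
  (h2 : (c 2)%:R * u 1%N + (k - (b 2)%:R - (c 2)%:R) * u 2 + (b 2)%:R * u 3 = t * u 2)
  (h3 : (c 3)%:R * u 2 + (k - (c 3)%:R) * u 3 = t * u 3).

(** The hypotheses are the three-term recurrence of the standard sequence of [t]: [dist_shift u] is
    [t * u] on distances 0 to 3. *)
Lemma dist_mx_eigen : D u *m A = t *: D u.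
Proof.
have tA : A^T = A by rewrite (adjmxE e_irr dr) (tr_dist_mx e_sym dr).
rewrite -{1}(tr_dist_mx e_sym dr) -{1}tA -trmx_mul (adj_dist_mx e_sym e_irr dr).
rewrite (tr_dist_mx e_sym dr); transitivity (D (fun i => t * u i)).
  apply: (eq_dist_mx dr);
    rewrite /dist_shift /= ?(c1E e_sym e_irr dr) ?(b3E dr).
  - by rewrite -h0; ring.
  - by rewrite -h1; ring.
  - by rewrite -h2; ring.
  - by rewrite -h3; ring.
by apply/matrixP => i j; rewrite !mxE.
Qed.

Definition eigen_scale : R := u 0%N + u 1%N * t + u 2 * eigen2 t + u 3 * eigen3 t.

Lemma dist_mx_sqr : D u *m D u = eigen_scale *: D u.
Proof. exact: (mulmx_dist dist_mx_eigen). Qed.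

(** Divided by [eigen_scale], [D u] is idempotent with constant diagonal; its trace is its rank, the
    multiplicity of [t]. *)
Lemma dist_mx_multiplicity : eigen_scale != 0 ->
  exists m : nat, eigen_scale * m%:R = #|T|%:R * u 0%N.
Proof.
move=> mu0; pose E := eigen_scale^-1 *: D u.
have EE : E *m E = E.
  by rewrite /E -scalemxAl -scalemxAr dist_mx_sqr !scalerA divfK.
exists (\rank E); rewrite -(mxtrace_idem EE) /E mxtraceZ mulrA divff // mul1r.
rewrite /mxtrace; under eq_bigr => i _.
  rewrite mxE (_ : dist e _ _ = 0%N); last by apply/eqP; rewrite dist_eq0; case: dr.
  over.
by rewrite sumr_const card_ord mulr_natl.
Qed.

Lemma dist_mx_eigenvalue : u 0%N != 0 -> is_eigenvalue e t.
Proof.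
move=> u0; have [x _] := diameter_chain dr.
apply/eigenvalueP; exists (row (enum_rank x) (D u)).
  by rewrite -row_mul dist_mx_eigen linearZ.
apply/eqP => /rowP/(_ (enum_rank x)); rewrite !mxE.
rewrite (_ : dist e _ _ = 0%N); first by apply/eqP.
by apply/eqP; rewrite dist_eq0; case: dr.
Qed.

End RightEigen.
(** In the double sum of [hadamard_psd] every row contributes the same amount, so one row already
    has a nonnegative sum. *)
Lemma krein (u v : nat -> R) (mu nu : R) :
  D u *m D u = mu *: D u -> D v *m D v = nu *: D v -> 0 < mu -> 0 < nu ->
  0 <= u 0%N ^+ 2 * v 0%N + u 1%N ^+ 2 * v 1%N * k + u 2 ^+ 2 * v 2 * eigen2 k
       + u 3 ^+ 2 * v 3 * eigen3 k.
Proof.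
move=> uu vv mu0 nu0; have [x _] := diameter_chain dr.
have T0 : 0 < #|T|%:R :> R by rewrite ltr0n; apply/card_gt0P; exists x.
rewrite -(pmulr_rge0 _ T0).
have := hadamard_psd (tr_dist_mx e_sym dr u)
  (tr_dist_mx e_sym dr v) uu vv mu0 nu0.
under eq_bigr => i _.
  under eq_bigr => j _ do rewrite !mxE.
  rewrite (sum_enum_val (fun y => u (dist e (enum_val i) y) ^+ 2 * v (dist e (enum_val i) y))).
  rewrite (sum_dist (fun d => u d ^+ 2 * v d)); over.
by rewrite sumr_const card_ord -[X in 0 <= X -> _]mulr_natl.
Qed.

End Spectrum.

(** * The claw bound *)

Section Claw.
Variables (T : finType) (e : rel T) (b c : nat -> nat).
Hypotheses (e_sym : symmetric e) (e_irr : irreflexive e).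
Hypothesis dr : distance_regular e 3 b c.
Local Open Scope nat_scope.

Let conn : connected_graph e. Proof. by case: dr. Qed.

Variable x : T.

(** The closed neighbourhood of [y] in the local graph at [x]. *)
Let cnbr (y : T) : {set T} := [set z | e x z && ((z == y) || e y z)].

Lemma card_cnbr y : e x y -> #|cnbr y| = b 0 - b 1.
Proof.
move=> xy; have xy1 : dist e x y = 1 by apply/eqP; rewrite dist_eq1.
have /= := card_farther dr x y; rewrite xy1 => <-.
have /eqP yy : dist e y y == 0 by rewrite dist_eq0.
have yx : e y x by rewrite e_sym.
have xx : dist e x x == 0 by rewrite dist_eq0.
rewrite -(card_nbrs e_irr dr y).
(* Both sets consist of the common neighbours of [x] and [y] and one more point: [y] on the left,
   [x] on the right. *)
have -> : #|cnbr y| = #|[set z | e y z && (dist e x z != 2)]|.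
  have -> : cnbr y = y |: [set z | e y z && (dist e x z == 1)].
    apply/setP => z; rewrite !inE dist_eq1 // andb_orr [e x z && e y z]andbC.
    by case: eqP => [->|_]; rewrite ?xy ?andbF.
  have -> : [set z | e y z && (dist e x z != 2)] = x |: [set z | e y z && (dist e x z == 1)].
    apply/setP => z; rewrite !inE; case: (eqVneq z x) => [->|zx]; first by rewrite yx (eqP xx).
    rewrite /=; case yz: (e y z) => //=.
    have := dist_nbr e_sym dr x yz; rewrite xy1 /=.
    by rewrite dist_eq0 // eq_sym (negPf zx) /= => /orP[] /eqP ->.
  by rewrite !cardsU1 !inE e_irr (eqP xx) andbF.
rewrite -(cardsID [set z | dist e x z == 2] [set z | e y z]).
have -> : [set z | e y z] :&: [set z | dist e x z == 2] =
    [set z | e y z && (dist e x z == 2)] by apply/setP => z; rewrite !inE.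
by rewrite addKn; apply: eq_card => z; rewrite !inE andbC.
Qed.

(** Here [y] and [z] are at distance 2, and one of their [c 2] common neighbours is [x], which lies
    outside the local graph. *)
Lemma card_cnbrI y z : e x y -> e x z -> z \notin cnbr y ->
  #|cnbr y :&: cnbr z| <= (c 2).-1.
Proof.
move=> xy xz; rewrite inE xz /= negb_or => /andP[zy yz].
have yx : e y x by rewrite e_sym.
have yz2 : dist e y z = 2.
  apply/eqP; rewrite eqn_leq; apply/andP; split.
    have := dist_edge conn y xz.
    by have /eqP -> : dist e y x == 1 by rewrite dist_eq1.
  have : dist e y z != 0 by rewrite dist_eq0 // eq_sym.
  have : dist e y z != 1 by rewrite dist_eq1.
  lia.
have /= := card_closer dr y z; rewrite yz2 /= => <-.
rewrite [X in _ <= X.-1](cardsD1 x) inE e_sym xz dist_eq1 // yx /=.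
apply/subset_leq_card/subsetP => w; rewrite !inE.
case/andP=> /andP[xw /orP[/eqP ->|yw]].
  by rewrite xy eq_sym (negPf zy) e_sym (negPf yz).
rewrite xw /= => /orP[/eqP wz|zw]; first by rewrite -wz yw in yz.
rewrite zw dist_eq1 // yw !andbT.
by apply/negP => /eqP wx; rewrite wx e_irr in xw.
Qed.

(* [U] is the union of the closed neighbourhoods, in the local graph at [x], of
   [m] pairwise nonadjacent vertices. *)
Lemma coclique_cover m : m.-1 * (b 0 - b 1) < b 0 ->
  exists U : {set T}, [/\ U \subset [set z | e x z], #|U| <= m * (b 0 - b 1),
    m * (b 0 - b 1) <= #|U| + 'C(m, 2) * (c 2).-1 &
    forall y, e x y -> y \notin U -> #|U :&: cnbr y| <= m * (c 2).-1].
Proof.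
elim: m => [|m IH] lt.
  by exists set0; split; rewrite ?sub0set ?cards0 // => y _ _; rewrite set0I cards0.
case: IH => [|U [Ux U1 U2 U3]]; first by apply: leq_ltn_trans lt; rewrite leq_mul2r leq_pred orbT.
(* [U] is too small to contain all neighbours of [x], so the coclique can be enlarged greedily. *)
have [y xy yU] : exists2 y, e x y & y \notin U.
  have : ~~ ([set z | e x z] \subset U).
    apply/negP => /subset_leq_card; rewrite (card_nbrs e_irr dr) leqNgt.
    by rewrite (leq_ltn_trans U1).
  by case/subsetPn => y; rewrite inE; exists y.
have cU := cardsUI U (cnbr y); have UI := U3 y xy yU; have cy := card_cnbr xy.
exists (U :|: cnbr y); split.
- by rewrite subUset Ux; apply/subsetP => z; rewrite !inE => /andP[].
- lia.
(* The new neighbourhood meets [U] in at most [m * (c 2).-1] points; these losses add up to the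
   binomial coefficient. *)
- rewrite binS bin1 !mulnDl mulSn; lia.
- move=> z xz; rewrite inE negb_or => /andP[zU zy].
  rewrite setIUl mulSn addnC; apply: leq_trans (leq_card_setU _ _) _.
  by rewrite leq_add ?U3 ?card_cnbrI.
Qed.

End Claw.

(** The union obtained from a coclique of size [m.+1] has to fit among the [b 0] neighbours of
    [x]. *)
Lemma claw_bound (T : finType) (e : rel T) (b c : nat -> nat) m :
  symmetric e -> irreflexive e -> distance_regular e 3 b c ->
  (m * (b 0 - b 1) < b 0)%N ->
  (m.+1 * (b 0 - b 1) <= b 0 + 'C(m.+1, 2) * (c 2).-1)%N.
Proof.
move=> e_sym e_irr dr lt; have [x _] := diameter_chain dr.
have [U [Ux _ U2 _]] := @coclique_cover _ _ _ _ e_sym e_irr dr x m.+1 lt.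
apply: leq_trans U2 _; rewrite leq_add2r -(card_nbrs e_irr dr x).
exact: subset_leq_card.
Qed.

(** * Diophantine constraints *)

Section Growth.
Variable R : realFieldType.

(** [K] bounds [a] from below by a quintic in [b]; eliminating [W] and [s] between [K] and [E]
    bounds it from above, and the two bounds are incompatible. *)
Lemma growth_contra (b a s W d d0 : R) :
  3 <= b -> 0 < a -> b ^+ 2 - 2 < s -> s < b ^+ 2 -> W = s - b + d ->
  (b - 1) * s * W <= (b ^+ 2 - s) * (s + a) ->
  d * (a * b + b - d) * (a + b - d) = (s - b) * W * (2 * (b + 1) * a + 4 * b - 3 * d) ->
  d0 <= d -> (d0 = 2) \/ (d0 = 1 /\ 5 <= b) -> False.
Proof.
move=> b3 a0 s1 s2 We K E dd d0P.
have d01 : 1 <= d0 <= 2 by case: d0P => [->|[-> _]]; lra.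
have [d1 d2] := andP d01.
set X := s + a in K.
have s7 : 7 <= s by nra.
have X0 : 0 < X by rewrite /X; lra.
have W1 : b ^+ 2 - b - 2 + d0 < W by lra.
have b22 : 0 <= b ^+ 2 - 2 by nra.
have bb0 : 0 <= b ^+ 2 - b - 6 by nra.
have W0 : 0 < W by lra.
have KX : (b - 1) * s * W <= 2 * X.
  by apply: (le_trans K); rewrite ler_wpM2r //; lra.
have X1 : (b - 1) * (b ^+ 2 - 2) * (b ^+ 2 - b - 2 + d0) <= 2 * X.
  apply: le_trans KX; apply: ler_pM; [nra|lra| |lra].
  by rewrite ler_wpM2l //; lra.
have W7 : 7 * W <= X.
  have : 14 * W <= (b - 1) * s * W by rewrite ler_wpM2r //; nra.
  lra.
have X3 : 3 * b ^+ 2 <= X.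
  have h : 14 * (b ^+ 2 - b - 1) <= (b - 1) * (b ^+ 2 - 2) * (b ^+ 2 - b - 2 + d0).
    by apply: ler_pM; [lra|lra|nra|lra].
  nra.
have a23 : 2 * X <= 3 * a by rewrite /X in X3 *; lra.
have dW : d <= W by lra.
(* The left side of [E] increases with [d] while [d] is small against [a + b], so its value at [d0]
   is a lower bound. *)
have hd : d0 * (a * b + b - d0) * (a + b - d0) <= d * (a * b + b - d) * (a + b - d).
  rewrite -subr_ge0.
  set P := a * b + b; set Q := a + b.
  rewrite (_ : _ - _ = (d - d0) * (P * Q - (P + Q) * (d + d0) + (d ^+ 2 + d * d0 + d0 ^+ 2)));
    last by ring.
  apply: mulr_ge0; first lra.
  have dQ : 2 * (d + d0) <= Q by rewrite /Q; lra.
  have QP : Q <= P by rewrite /Q /P; nra.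
  have Q0 : 0 < Q by rewrite /Q; lra.
  have : 0 <= (P + Q) * (Q - 2 * (d + d0)) by apply: mulr_ge0; lra.
  have : 0 <= (P - Q) * Q by apply: mulr_ge0; lra.
  have : 0 <= d ^+ 2 + d * d0 + d0 ^+ 2 by nra.
  nra.
set L := 2 * (b + 1) * a + 4 * b - 3 * d0.
have L0 : 0 < L.
  by have := mulr_gt0 (_ : 0 < b + 1) a0; rewrite /L; lra.
have Y0 : 0 < s - b by lra.
(* Multiplying [E] by [(b - 1) * s] and bounding [(b - 1) * s * W] by [K] eliminates [W]. *)
have h6 : (b - 1) * s * (d0 * (a * b + b - d0) * (a + b - d0)) <=
    (s - b) * (b ^+ 2 - s) * X * L.
  have s0 : 0 <= (b - 1) * s by rewrite mulr_ge0 //; lra.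
  apply: (le_trans (ler_wpM2l s0 hd)); rewrite E.
  apply: (@le_trans _ _ ((b - 1) * s * ((s - b) * W * L))).
    apply: ler_wpM2l => //; apply: ler_wpM2l; first by rewrite mulr_ge0 //; lra.
    by rewrite /L; lra.
  rewrite [leLHS](_ : _ = ((s - b) * L) * ((b - 1) * s * W)); last by ring.
  rewrite [leRHS](_ : _ = ((s - b) * L) * ((b ^+ 2 - s) * X)); last by ring.
  by rewrite ler_wpM2l // mulr_ge0 //; lra.
(* Both sides agree at [s = b ^+ 2 - 2], hence the linear factor in the difference. *)
have h7 : (s - b) * (b ^+ 2 - s) * (b ^+ 2 - 2) <= 2 * (b ^+ 2 - b - 2) * s.
  rewrite -subr_ge0 (_ : _ - _ = (s - (b ^+ 2 - 2)) *
    ((b ^+ 2 - b - 2) * b ^+ 2 - (b ^+ 2 - 2) * (b ^+ 2 - s))); last by ring.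
  apply: mulr_ge0; first lra.
  have : (b ^+ 2 - 2) * (b ^+ 2 - s) <= (b ^+ 2 - 2) * 2 by rewrite ler_wpM2l //; lra.
  have : 4 * b ^+ 2 <= (b ^+ 2 - b - 2) * b ^+ 2 by rewrite ler_wpM2r ?sqr_ge0 //; lra.
  lra.
have h8 : (b ^+ 2 - 2) * (b - 1) * (d0 * (a * b + b - d0) * (a + b - d0)) <=
    2 * (b ^+ 2 - b - 2) * X * L.
  rewrite -(ler_pM2l (_ : 0 < s)); last lra.
  have := ler_wpM2l b22 h6; have := ler_wpM2r (ltW (mulr_gt0 X0 L0)) h7.
  set h := d0 * _ * _ => i1 i2.
  rewrite (_ : s * _ = (b ^+ 2 - 2) * ((b - 1) * s * h)); last by ring.
  rewrite (_ : s * _ = 2 * (b ^+ 2 - b - 2) * s * (X * L)); last by ring.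
  apply: (le_trans i2); rewrite [leLHS](_ : _ = (s - b) * (b ^+ 2 - s) * (b ^+ 2 - 2) * (X * L)) //.
  by ring.
(* This bound allows [L] to be cancelled from [h8], which leaves the inequality [h10] for [a]. *)
have h9 : b * a * L <= 2 * (b + 1) * ((a * b + b - d0) * (a + b - d0)).
  rewrite /L -subr_ge0 (_ : _ - _ = a * (2 * (b + 1) ^+ 2 * (b - d0) - b * (4 * b - 3 * d0))
    + 2 * (b + 1) * (b - d0) ^+ 2); last by ring.
  apply: addr_ge0; last by rewrite mulr_ge0 ?sqr_ge0 //; lra.
  apply: mulr_ge0; first lra.
  case: d0P => [->|[-> b5]]; clear -b3; nra.
have h10 : (b ^+ 2 - 2) * (b - 1) * d0 * b * a <= 4 * (b ^+ 2 - b - 2) * (b + 1) * X.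
  rewrite -(ler_pM2l L0).
  have i1 : 0 <= (b ^+ 2 - 2) * (b - 1) * d0.
    by apply: mulr_ge0; [apply: mulr_ge0|]; lra.
  have i2 : 0 <= 2 * (b + 1) by lra.
  have := ler_wpM2l i1 h9; have := ler_wpM2l i2 h8.
  lra.
have {}h10 : (b ^+ 2 - 2) * (b - 1) * d0 * b * a <= 4 * (b ^+ 2 - b - 2) * (b + 1) * (b ^+ 2 + a).
  apply: (le_trans h10); apply: ler_wpM2l; last by rewrite /X; lra.
  by apply: mulr_ge0; lra.
have {}X1 : (b - 1) * (b ^+ 2 - 2) * (b ^+ 2 - b - 2 + d0) <= 2 * (b ^+ 2 + a).
  by rewrite /X in X1; lra.
(* [h10] will serve as [k * a <= m] and [X1] as [l <= 2 * a]. For [d0 = 1] the coefficient [k] is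
   negative at [b = 3] and [b = 4], whence the condition [5 <= b]. *)
have fin (k l m : R) : 0 < k -> k * a <= m -> l <= 2 * a -> 2 * m < k * l -> False.
  by clear => k0 h1 h2 h3; have := ler_wpM2l (ltW k0) h2; lra.
case: d0P => [d0E|[d0E b5]]; rewrite d0E in h10 X1.
  have [x xE] : exists x, b = 3 + x by exists (b - 3); ring.
  have x1 : 0 <= x by lra.
  rewrite xE in h10 X1; clear -h10 X1 x1 fin.
  have x2 := mulr_ge0 x1 x1; have x3 := mulr_ge0 x1 x2; have x4 := mulr_ge0 x1 x3.
  have x5 := mulr_ge0 x1 x4; have x6 := mulr_ge0 x1 x5; have x7 := mulr_ge0 x1 x6.
  have x8 := mulr_ge0 x1 x7; have x9 := mulr_ge0 x1 x8.
  (* The coefficients read off [h10] and [X1], expanded in [x = b - 3]; [2 * m < k * l] then holds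
     coefficient by coefficient. *)
  apply: (fin (20 + 46 * x + 50 * x ^+ 2 + 18 * x ^+ 3 + 2 * x ^+ 4)
    (66 + 172 * x + 155 * x ^+ 2 + 65 * x ^+ 3 + 13 * x ^+ 4 + x ^+ 5)
    (576 + 1248 * x + 964 * x ^+ 2 + 348 * x ^+ 3 + 60 * x ^+ 4 + 4 * x ^+ 5)).
  - lra.
  - lra.
  - lra.
  - lra.
have [x xE] : exists x, b = 5 + x by exists (b - 5); ring.
have x1 : 0 <= x by lra.
rewrite xE in h10 X1; clear -h10 X1 x1 fin.
have x2 := mulr_ge0 x1 x1; have x3 := mulr_ge0 x1 x2; have x4 := mulr_ge0 x1 x3.
have x5 := mulr_ge0 x1 x4; have x6 := mulr_ge0 x1 x5; have x7 := mulr_ge0 x1 x6.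
have x8 := mulr_ge0 x1 x7; have x9 := mulr_ge0 x1 x8.
apply: (fin (28 + 119 * x + 73 * x ^+ 2 + 15 * x ^+ 3 + x ^+ 4)
  (1698 + 2005 * x + 923 * x ^+ 2 + 208 * x ^+ 3 + 23 * x ^+ 4 + x ^+ 5)
  (10800 + 11520 * x + 4812 * x ^+ 2 + 988 * x ^+ 3 + 100 * x ^+ 4 + 4 * x ^+ 5)).
- lra.
- lra.
- lra.
- lra.
Qed.
End Growth.

(** * Integrality and rational roots *)

Section Integers.
Variable R : realDomainType.
Implicit Types z w : R.

Definition is_int z := exists u : int, z = u%:~R.

Lemma is_int_nat n : is_int (n%:R : R). Proof. by exists n%:Z; rewrite pmulrn. Qed.
Lemma is_intN z : is_int z -> is_int (- z).
Proof. by move=> [u ->]; exists (- u); rewrite rmorphN. Qed.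
Lemma is_intD z w : is_int z -> is_int w -> is_int (z + w).
Proof. by move=> [u ->] [v ->]; exists (u + v); rewrite rmorphD. Qed.
Lemma is_intM z w : is_int z -> is_int w -> is_int (z * w).
Proof. by move=> [u ->] [v ->]; exists (u * v); rewrite rmorphM. Qed.
Lemma is_intX z n : is_int z -> is_int (z ^+ n).
Proof. by move=> [u ->]; exists (u ^+ n); rewrite rmorphXn. Qed.

Lemma is_int_ge1 z : is_int z -> 0 < z -> 1 <= z.
Proof. by move=> [u ->]; rewrite ltr0z ler1z; lia. Qed.

(* Infinite descent on the denominator: [`|v * z| < v] is again a denominator of [z]. *)
Lemma small_rational_root z p q v :
  is_int p -> is_int q -> z ^+ 2 + p * z + q = 0 -> `|z| < 1 ->
  is_int v -> v != 0 -> is_int (v * z) -> z = 0.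
Proof.
move=> pint qint zr z1 [n ->]; have [m] := ubnP (absz n).
elim: m n => // m IH n lt n0 int_nz; apply/eqP/negPn/negP => z0.
have [u uE] := int_nz; apply: (negP z0); apply/eqP; apply: (IH u).
- have : `|u%:~R| < `|n%:~R| :> R.
    by rewrite -uE normrM gtr_pMr // normr_gt0.
  by rewrite -!intr_norm ltr_int; lia.
- by rewrite -uE mulf_neq0.
rewrite -uE (_ : n%:~R * z * z
    = n%:~R * (z ^+ 2 + p * z + q) - (p * (n%:~R * z) + n%:~R * q)); last by ring.
rewrite zr mulr0 sub0r.
by apply/is_intN/is_intD; apply: is_intM => //; exists n.
Qed.

End Integers.

(* [64 (3a+2)(a+2) + 77 = (8a+9)(24a+37)], so [8a+9] divides [77]. *)
Lemma no_unit_gap3 (a c : nat) : (0 < a)%N ->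
  ((3 * a + 2) * (a + 2) = 2 * c * (8 * a + 9))%N -> False.
Proof.
move=> a0 E.
have : (8 * a + 9 %| 77)%N.
  rewrite -(@dvdn_addr (64 * ((3 * a + 2) * (a + 2)))).
    by apply/dvdnP; exists (3 * (8 * a + 9) + 10)%N; nia.
  by rewrite E; apply/dvdnP; exists (64 * (2 * c))%N; nia.
move=> dv; have le := @dvdn_leq _ 77 isT dv.
have : (a <= 8)%N by lia.
by case: a dv a0 {E le} => [|[|[|[|[|[|[|[|[|a]]]]]]]]].
Qed.

(* [50 (4a+3)(a+3) + 187 = (10a+13)(20a+49)], so [10a+13] divides [187]. *)
Lemma no_unit_gap4 (a c : nat) : (0 < a)%N ->
  ((4 * a + 3) * (a + 3) = 3 * c * (10 * a + 13))%N -> False.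
Proof.
move=> a0 E.
have : (10 * a + 13 %| 187)%N.
  rewrite -(@dvdn_addr (50 * ((4 * a + 3) * (a + 3)))).
    by apply/dvdnP; exists (2 * (10 * a + 13) + 23)%N; nia.
  by rewrite E; apply/dvdnP; exists (50 * (3 * c))%N; nia.
move=> dv; have le := @dvdn_leq _ 187 isT dv.
have : (a <= 17)%N by lia.
by case: a dv a0 {E le} =>
  [|[|[|[|[|[|[|[|[|[|[|[|[|[|[|[|[|[|a]]]]]]]]]]]]]]]]]].
Qed.

(* The case [b = 3], [theta_3 = -8], [c_2 = 5t], [theta_2 = 2t - 3]. *)
Lemma no_multiplicities3 (a t m2 m3 : int) :
  0 < t -> 32 * t <= a + 8 -> a <= 30 * t + 2 ->
  m2 * (2 * t * (a + 3 - 2 * t) * (2 * t + 5)) = 6 * a * (a + 1) * (3 * a + 8) ->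
  m3 * (5 * (a + 8) * (2 * t + 5)) = 6 * a * (a + 1) * (3 * a + 3 - 2 * t) -> False.
Proof.
move=> t0 h1 h2.
(* Since [32 * t - 8 <= a <= 30 * t + 2], the excess [j] is at most [10 - 2 * t]. For each of the
   finitely many pairs left, one multiplicity is not an integer. *)
have [j [ja j8]] : exists j : nat, a = 32 * t - 8 + j%:Z /\ (j < 9)%N.
  by exists (absz (a - (32 * t - 8))%R); lia.
have [k kt] : exists k : nat, t = k.+1%:Z by exists (absz (t - 1)%R); lia.
have k5 : (k < 5)%N by lia.
rewrite ja kt in h2 *; clear t0 h1 ja kt t a.
case: k k5 h2 => [|[|[|[|[|k]]]]] //= _;
  case: j j8 => [|[|[|[|[|[|[|[|[|j]]]]]]]]] //= _; lia.
Qed.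

(* [x] and [y] stand for [a_3] and [b], [t] and [r] for [theta_3] and [theta_2]. *)
Section SmallRoot.
Variables (R : realFieldType) (x y b2 c2 t s r Y W : R).
Hypotheses (sE : s = - t) (rE : r = - (y + b2 + c2 - x) - t) (YE : Y = s - y)
  (WE : W = r + y).
Hypotheses (x0 : 0 < x) (y3 : 3 <= y) (yx : y <= x) (b20 : 0 < b2) (c20 : 0 < c2).
Hypotheses (ft : t ^+ 2 + (y + b2 + c2 - x) * t + y * b2 + c2 - x * y = 0)
  (t_lt : t < - y ^+ 2 + 2).

(* [lra] ignores section hypotheses. *)
Local Ltac sec_lra :=
  move: x0 y3 yx b20 c20 t_lt => *; lra.

Lemma quadratic_factor z :
  z ^+ 2 + (y + b2 + c2 - x) * z + y * b2 + c2 - x * y = (z - t) * (z - r).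
Proof. by rewrite -[LHS]subr0 -ft rE; ring. Qed.

Lemma s_gt : y ^+ 2 - 2 < s. Proof. by rewrite sE; sec_lra. Qed.

Lemma y2_ge : 3 * y <= y ^+ 2. Proof. by rewrite expr2 ler_wpM2r //; sec_lra. Qed.

Lemma Y_gt0 : 0 < Y. Proof. by have := s_gt; have := y2_ge; rewrite YE; sec_lra. Qed.

(** Both sides are minus the value of the quadratic at [- y]. *)
Lemma YW : Y * W = (y - 1) * c2.
Proof.
transitivity (- (((- y) ^+ 2 + (y + b2 + c2 - x) * (- y) + y * b2 + c2 - x * y))); last by ring.
by rewrite quadratic_factor YE WE sE; ring.
Qed.

Lemma W_gt0 : 0 < W.
Proof. by rewrite -(pmulr_rgt0 _ Y_gt0) YW mulr_gt0 //; sec_lra. Qed.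

Lemma s_gt0 : 0 < s. Proof. by have := Y_gt0; rewrite YE; sec_lra. Qed.

Lemma rs_gt0 : 0 < r + s. Proof. by have := Y_gt0; have := W_gt0; rewrite YE WE; sec_lra. Qed.

(** At [x] the quadratic is positive and equals [(x - t) * (x - r)], where [x - t] is positive. *)
Lemma xr_gt0 : 0 < x - r.
Proof.
have xt : 0 < x - t by have := s_gt0; rewrite sE; sec_lra.
rewrite -(pmulr_rgt0 _ xt) -quadratic_factor.
rewrite [ltRHS](_ : _ = b2 * (x + y) + (x + 1) * c2); last by ring.
by rewrite addr_gt0 ?mulr_gt0 //; sec_lra.
Qed.

Lemma xyr_gt0 : 0 < x * y - r.
Proof.
have : x * 1 <= x * y by rewrite ler_pM2l //; sec_lra.
by have := xr_gt0; sec_lra.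
Qed.

Lemma xys_gt0 : 0 < x * y + s.
Proof. by rewrite addr_gt0 ?s_gt0 // mulr_gt0 //; sec_lra. Qed.

Lemma b2_of_W : b2 = x + s - W - c2. Proof. by rewrite WE rE sE; ring. Qed.

Section Krein.
Hypothesis kr : c2 * (- t - y) <= (y ^+ 2 + t) * b2.

(** The Krein condition after [b2] and [c2] are eliminated by the sum of the roots and by [YW]. *)
Lemma krein_s : (y - 1) * s * W <= (y ^+ 2 - s) * (s + x).
Proof.
have y1 : 0 < y - 1 by sec_lra.
rewrite -subr_ge0 -(pmulr_rge0 _ y1).
have h : 0 <= (y - 1) * ((y ^+ 2 + t) * b2 - c2 * (- t - y)).
  by rewrite pmulr_rge0 // subr_ge0.
apply: le_trans h _; rewrite le_eqVlt; apply/orP; left; apply/eqP.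
transitivity ((y ^+ 2 - s) * ((y - 1) * (x + s - W) - (y - 1) * c2) - (y - 1) * c2 * (s - y)).
  by rewrite b2_of_W sE; ring.
by rewrite -YW YE; ring.
Qed.

Lemma s_lt : s < y ^+ 2.
Proof.
have h1 : 0 < (y - 1) * s * W by rewrite !mulr_gt0 ?s_gt0 ?W_gt0 //; sec_lra.
have := lt_le_trans h1 krein_s.
by rewrite pmulr_lgt0 ?subr_gt0 // addr_gt0 // s_gt0.
Qed.

(** The Krein condition bounds [x] from below and the claw bound from above, both linearly in an
    integer [u >= 1]; together they fail for [4 <= y]. *)
Lemma integral_contra : is_int y -> is_int W -> is_int c2 -> 4 <= y ->
  2 * x + 2 - y ^+ 2 + y <= y * (y + 1) * c2 -> s = y ^+ 2 - 1 -> False.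
Proof.
(* As [Y = y ^+ 2 - y - 1] satisfies [y * (y - 1) - Y = 1], [YW] forces [W = (y - 1) * u] and
   [c2 = Y * u] for this [u]. *)
move=> yI WI c2I y4 claw sy; pose u := y * W - c2.
have Wu : W = (y - 1) * u.
  have := YW; rewrite YE sy => h; rewrite /u mulrBr -h; ring.
have cu : c2 = (y ^+ 2 - 1 - y) * u.
  have y1 : y - 1 != 0 by rewrite gt_eqF //; lra.
  by apply: (mulfI y1); rewrite -YW YE sy Wu; ring.
have uI : is_int u by apply/is_intD/is_intN => //; apply: is_intM.
have u1 : 1 <= u.
  apply: is_int_ge1 uI _; have y1 : 0 < y - 1 by lra.
  by rewrite -(pmulr_rgt0 _ y1) -Wu W_gt0.
have := krein_s; rewrite Wu sy => kr'; rewrite cu in claw.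
have h : (y + 1) * ((y ^+ 3 - 5 * y ^+ 2 + 7 * y - 2) * u) <= (y + 1) * (3 * y - 4) by lra.
have {h} : (y ^+ 3 - 5 * y ^+ 2 + 7 * y - 2) * u <= 3 * y - 4.
  by rewrite -(ler_pM2l (_ : 0 < y + 1)) //; lra.
have yy : 0 <= (y - 4) * (y * (y - 1)) by rewrite !mulr_ge0 //; lra.
have big : 3 * y - 4 < y ^+ 3 - 5 * y ^+ 2 + 7 * y - 2 by lra.
have : (y ^+ 3 - 5 * y ^+ 2 + 7 * y - 2) * 1 <= (y ^+ 3 - 5 * y ^+ 2 + 7 * y - 2) * u.
  by rewrite ler_wpM2l //; lra.
lra.
Qed.

Section Multiplicities.
Variables m2 m3 : nat.
Hypotheses (m2E : m2%:R * (W * (x - r) * (r + s)) = x * y * (x + 1) * (y - 1) * (x * y + s))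
  (m3E : m3%:R * (Y * (x + s) * (r + s)) = x * y * (x + 1) * (y - 1) * (x * y - r)).
Hypotheses (xI : is_int x) (yI : is_int y) (b2I : is_int b2) (c2I : is_int c2).

Lemma mult_ratio : m2%:R * (W * (x - r) * (x * y - r)) = m3%:R * (Y * (x + s) * (x * y + s)).
Proof.
have rs0 : r + s != 0 by rewrite gt_eqF ?rs_gt0.
apply: (mulIf rs0).
transitivity (m2%:R * (W * (x - r) * (r + s)) * (x * y - r)); first by ring.
rewrite m2E; transitivity (m3%:R * (Y * (x + s) * (r + s)) * (x * y + s)); last by ring.
by rewrite m3E; ring.
Qed.

Lemma right_gt0 : 0 < Y * (x + s) * (x * y + s).
Proof. by rewrite !mulr_gt0 ?Y_gt0 ?xys_gt0 // addr_gt0 ?s_gt0. Qed.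

Lemma left_gt0 : 0 < W * (x - r) * (x * y - r).
Proof. by rewrite !mulr_gt0 ?W_gt0 ?xr_gt0 ?xyr_gt0. Qed.

Lemma m2_gt0 : (0 < m2)%N.
Proof.
rewrite lt0n -(pnatr_eq0 R); apply/eqP => m0.
move: m2E; rewrite m0 mul0r => /esym/eqP; rewrite gt_eqF // !mulr_gt0 ?xys_gt0 //; sec_lra.
Qed.

(* [m2 != m3] turns the ratio of the multiplicity formulas into a nontrivial linear
   equation for [s] with integer coefficients. *)
Lemma mults_neq : m2 != m3 -> s = y ^+ 2 - 1.
Proof.
move=> mm.
pose p := y + b2 + c2 - x; pose q := y * b2 + c2 - x * y.
have pI : is_int p by rewrite /p; do ?[apply: is_intD|apply: is_intN].
have qI : is_int q by rewrite /q; do ?[apply: is_intD|apply: is_intN|apply: is_intM].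
have natI n : is_int (n%:R : R) := is_int_nat R n.
have oneI : is_int (1 : R) := is_int_nat R 1.
have twoI : is_int (2 : R) := is_int_nat R 2.
pose n := y ^+ 2 - 1.
have nI : is_int n by apply/is_intD/is_intN => //; apply: is_intX.
have sq : s ^+ 2 = p * s - q.
  by apply/eqP; rewrite -subr_eq0 sE -ft /p /q; apply/eqP; ring.
(* [Y * (x + s) * (x * y + s)] is a monic cubic in [s] with coefficients [e2] and [e1]; modulo [sq]
   it reduces to [al + be * s]. The other side of [mult_ratio] is minus the same cubic at the
   conjugate [p - s]. *)
pose e2 := x * y + x - y; pose e1 := x ^+ 2 * y - x * y ^+ 2 - x * y.
pose be := p ^+ 2 - q + e2 * p + e1.
pose al := - p * q - e2 * q - x ^+ 2 * y ^+ 2.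
have e2I : is_int e2 by rewrite /e2; do ?[apply: is_intD|apply: is_intN|apply: is_intM].
have e1I : is_int e1.
  by rewrite /e1; do ?[apply: is_intD|apply: is_intN|apply: is_intM|apply: is_intX].
have beI : is_int be.
  by rewrite /be; do ?[done|apply: is_intD|apply: is_intN|apply: is_intM|apply: is_intX].
have alI : is_int al.
  by rewrite /al; do ?[done|apply: is_intD|apply: is_intN|apply: is_intM|apply: is_intX].
have rp : r = s - p by rewrite rE sE /p; ring.
have rightE : Y * (x + s) * (x * y + s) = al + be * s.
  rewrite YE; transitivity (s * s ^+ 2 + e2 * s ^+ 2 + e1 * s - x ^+ 2 * y ^+ 2).
    by rewrite /e2 /e1; ring.
  rewrite sq; transitivity (p * s ^+ 2 - q * s + e2 * (p * s - q) + e1 * s - x ^+ 2 * y ^+ 2).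
    by ring.
  by rewrite sq /al /be; ring.
have leftE : W * (x - r) * (x * y - r) = - (al + be * (p - s)).
  rewrite WE rp.
  have sq' : (p - s) ^+ 2 = p * (p - s) - q.
    transitivity (p ^+ 2 - 2 * p * s + s ^+ 2); first by ring.
    by rewrite sq; ring.
  transitivity (- ((p - s) * (p - s) ^+ 2 + e2 * (p - s) ^+ 2 + e1 * (p - s) - x ^+ 2 * y ^+ 2)).
    by rewrite /e2 /e1; ring.
  rewrite sq'; transitivity (- (p * (p - s) ^+ 2 - q * (p - s) + e2 * (p * (p - s) - q)
    + e1 * (p - s) - x ^+ 2 * y ^+ 2)); first by ring.
  by rewrite sq' /al /be; ring.
(* Otherwise both [al] and [- al] would be positive. *)
have be0 : be != 0.
  apply/eqP => be0; have := left_gt0; have := right_gt0; rewrite leftE rightE be0; sec_lra.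
have mmR : m3%:R - m2%:R != 0 :> R by rewrite subr_eq0 eqr_nat eq_sym.
have := mult_ratio; rewrite leftE rightE => h.
pose v := be * (m3%:R - m2%:R).
have vs : v * s = - (m2%:R * (al + be * p)) - m3%:R * al.
  apply/eqP; rewrite -subr_eq0; apply/eqP; rewrite /v.
  transitivity (m3%:R * (al + be * s) - m2%:R * - (al + be * (p - s))); first by ring.
  by rewrite h subrr.
apply/eqP; rewrite -subr_eq0; apply/eqP.
(* The range [y ^+ 2 - 2 < s < y ^+ 2] puts [s] at distance less than 1 from [n]; the polynomial is
   that of [s], shifted by [n]. *)
apply: (@small_rational_root R (s - n) (2 * n - p) (n ^+ 2 - p * n + q) v).
- by do ?[done|apply: is_intD|apply: is_intN|apply: is_intM|apply: is_intX].
- by do ?[done|apply: is_intD|apply: is_intN|apply: is_intM|apply: is_intX].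
- transitivity (s ^+ 2 - (p * s - q)); first by ring.
  by rewrite sq subrr.
- by rewrite ltr_norml /n; have := s_gt; have := s_lt; sec_lra.
- by rewrite /v; do ?[done|apply: is_intD|apply: is_intN|apply: is_intM|apply: is_intX].
- by rewrite mulf_neq0.
rewrite mulrBr vs /v.
by do ?[done|apply: is_intD|apply: is_intN|apply: is_intM|apply: is_intX].
Qed.

Lemma mults_eq : m2 = m3 -> exists d, [/\ is_int d, 1 <= d, W = s - y + d &
  d * (x * y + y - d) * (x + y - d) = (s - y) * W * (2 * (y + 1) * x + 4 * y - 3 * d)].
Proof.
move=> mm; have m0 : m2%:R != 0 :> R by rewrite pnatr_eq0 -lt0n m2_gt0.
have := mult_ratio; rewrite -mm => /(mulfI m0) h.
(* This is [W - Y = 2 * y + r + t], in a form that is visibly integral. *)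
pose d := x + y - b2 - c2; exists d.
have WsE : W = s - y + d by rewrite /d b2_of_W; ring.
have E : d * (x * y + y - d) * (x + y - d) = (s - y) * W * (2 * (y + 1) * x + 4 * y - 3 * d).
  apply/eqP; rewrite -subr_eq0; apply/eqP.
  transitivity (W * (x - r) * (x * y - r) - Y * (x + s) * (x * y + s)); last by rewrite h subrr.
  rewrite YE (_ : r = W - y); last by rewrite WE addrK.
  by rewrite WsE; ring.
have dI : is_int d by rewrite /d; do ?[done|apply: is_intD|apply: is_intN].
split=> //; apply: is_int_ge1 dI _.
have xx : x * 3 <= x * y by rewrite ler_pM2l.
have pos : 0 < (x * y + y - d) * (x + y - d).
  by apply: mulr_gt0; rewrite /d; sec_lra.
rewrite -(pmulr_lgt0 _ pos) mulrA E !mulr_gt0 ?W_gt0 //; first by have := Y_gt0; rewrite YE.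
by rewrite /d; sec_lra.
Qed.

End Multiplicities.
End Krein.
End SmallRoot.

(** At the eigenvalue [a_3 = k - c_3] the left side of [eigen_quartic] vanishes, hence so does
    [eigen2], which reads [k = a_3 * (a_3 - a_1)]. *)
Lemma shilla_parameters (R : rcfType) (T : finType) (e : rel T) (b c : nat -> nat) :
  symmetric e -> irreflexive e -> shilla R e b c ->
  exists a g : nat, [/\ (0 < a)%N, (1 < g)%N, b 0%N = (a * g)%N,
    b 1%N = (a.+1 * g.-1)%N & c 3%N = (a * g.-1)%N] /\
    [/\ aparam b c 3%N = a, (g <= a)%N & (aparam b c 3%N)%:R - (aparam b c 1%N)%:R = g%:R :> R].
Proof.
move=> e_sym e_irr [dr [eva _]].
have b3 := b3E dr; have c1 := c1E e_sym e_irr dr.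
have c3k := c3_leq e_irr dr; have b1k := b1_ltn e_sym e_irr dr.
have b20 := b2_gt0 dr; have c20 := c2_gt0 e_sym dr.
have b10 := b1_gt0 dr; have c30 := c3_gt0 e_sym dr.
move: eva; set a := aparam b c 3%N; set a1 := aparam b c 1%N => eva.
have aE : (a + c 3 = b 0)%N by rewrite /a /aparam b3; lia.
have a1E : (a1 + b 1 + 1 = b 0)%N by rewrite /a1 /aparam c1; lia.
clearbody a a1.
have aR : a%:R = (b 0%N)%:R - (c 3%N)%:R :> R by rewrite -aE natrD addrK.
have a1R : a1%:R = (b 0%N)%:R - 1 - (b 1%N)%:R :> R by rewrite -a1E !natrD; ring.
have kE : (b 0 = a * a - a1 * a)%N /\ (a1 * a <= a * a)%N.
  have /eigenvalueP[v va v0] := eva.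
  have := eigen_quartic e_sym e_irr dr va v0.
  rewrite aR subrr mul0r -aR => /esym/eqP; rewrite mulf_eq0 pnatr_eq0 -leqn0 leqNgt b20 /=.
  rewrite /eigen2 mulf_eq0 invr_eq0 pnatr_eq0 -[_ == 0%N]leqn0 leqNgt c20 orbF -a1R.
  rewrite subr_eq add0r subr_eq => /eqP.
  rewrite expr2 -!natrM -natrD => /eqP; rewrite eqr_nat => /eqP; lia.
have [kE1 kE2] := kE; have lt : (a1 < a)%N.
  rewrite ltnNge; apply/negP => le; have := leq_mul le (leqnn a); lia.
have [g gE] : exists g, a = (a1 + g.+1)%N by exists (a - a1.+1)%N; lia.
have k2 : b 0%N = (a * g.+1)%N by rewrite kE1 -mulnBl {1}gE addKn mulnC.
have b1g : b 1%N = (a.+1 * g)%N by move: k2; rewrite mulnS mulSn; lia.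
exists a, g.+1; split; split=> //; try lia.
by rewrite {1}gE natrD addrAC subrr add0r.
Qed.

(** * Shilla graphs *)

Section Shilla.
Variables (R : rcfType) (T : finType) (e : rel T) (b c : nat -> nat) (a g : nat).
Hypotheses (e_sym : symmetric e) (e_irr : irreflexive e).
Hypothesis dr : distance_regular e 3 b c.
Hypotheses (a_gt0 : (0 < a)%N) (g_gt1 : (1 < g)%N).
Hypotheses (b0E : b 0%N = (a * g)%N) (b1E : b 1%N = (a.+1 * g.-1)%N)
  (c3E : c 3%N = (a * g.-1)%N).

Local Notation x := (@GRing.natmul R (GRing.one R) a).
Local Notation y := (@GRing.natmul R (GRing.one R) g).
Local Notation b2 := (@GRing.natmul R (GRing.one R) (b 2)).
Local Notation c2 := (@GRing.natmul R (GRing.one R) (c 2)).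

Let kR : (b 0)%:R = x * y. Proof. by rewrite b0E natrM. Qed.
Let b1R : (b 1)%:R = (x + 1) * (y - 1).
Proof. by rewrite b1E natrM -natr1 -subn1 natrB // ltnW. Qed.
Let c3R : (c 3)%:R = x * (y - 1).
Proof. by rewrite c3E natrM -subn1 natrB // ltnW. Qed.
Let x0 : 0 < x. Proof. by rewrite ltr0n. Qed.
Let y1 : 0 < y - 1. Proof. by rewrite subr_gt0 ltr1n. Qed.
Let y0 : 0 < y. Proof. by rewrite ltr0n ltnW. Qed.
Let x1 : 0 < x + 1. Proof. by rewrite addr_gt0. Qed.
Let b20 : 0 < b2. Proof. by rewrite ltr0n (b2_gt0 dr). Qed.
Let c20 : 0 < c2. Proof. by rewrite ltr0n (c2_gt0 e_sym dr). Qed.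

(** What remains of the equation in [eigen_quartic] after removal of the roots [x * y] and [x]; its
    roots are theta_2 and theta_3. *)
Definition shilla_quadratic (t : R) := t ^+ 2 + (y + b2 + c2 - x) * t + y * b2 + c2 - x * y.
Local Notation f := shilla_quadratic.

Lemma eigen2E t : eigen2 b c t = (t - x) * (t + y) / c2.
Proof. by rewrite /eigen2 kR b1R; congr (_ / _); ring. Qed.

(** Arranged so that the second summand disappears at the roots of the quadratic. *)
Lemma eigen3E t : eigen3 b c t = (b2 * (t + y) + (t - x * y) * f t / (x * (y - 1))) / c2.
Proof.
rewrite /eigen3 eigen2E kR b1R c3R /f; field.
by rewrite !gt_eqF.
Qed.

Lemma eigenvalue_root t : is_eigenvalue e t -> t != x * y -> t != x -> f t = 0.
Proof.
case/eigenvalueP => v vt v0 tk tx.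
have := eigen_quartic e_sym e_irr dr vt v0.
rewrite eigen3E eigen2E kR c3R => h.
have : (t - x) * (t - x * y) * f t = 0.
  have cn : c2 != 0 by rewrite gt_eqF.
  have xn : x != 0 by rewrite gt_eqF.
  have yn : y - 1 != 0 by rewrite gt_eqF.
  apply: (@mulIf _ (c2 * (x * (y - 1)))^-1); first by rewrite invr_eq0 !mulf_neq0.
  rewrite mul0r; move/eqP: h; rewrite -subr_eq0 => /eqP <-.
  by field; rewrite cn xn yn.
have tkx : (t - x) * (t - x * y) != 0 by rewrite mulf_neq0 ?subr_eq0.
by move/eqP; rewrite (mulf_eq0 _ (f t)) (negPf tkx) => /eqP.
Qed.

(* The standard sequence of [t], scaled by [x * y * (x + 1) * (y - 1)] to clear
   denominators. *)
Definition cosines (t : R) (i : nat) : R :=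
  nth 0 [:: x * y * (x + 1) * (y - 1); t * (x + 1) * (y - 1);
            (t - x) * (t + y); x * (y - 1) * (t + y)] i.

Section Root.
Variable t : R.
Hypothesis ft : f t = 0.

Let h0 : (b 0)%:R * cosines t 1 = t * cosines t 0.
Proof. by rewrite kR /cosines /=; ring. Qed.
Let h1 : cosines t 0 + ((b 0)%:R - 1 - (b 1)%:R) * cosines t 1 + (b 1)%:R * cosines t 2
  = t * cosines t 1.
Proof. by rewrite kR b1R /cosines /=; ring. Qed.
Let h2 : c2 * cosines t 1 + ((b 0)%:R - b2 - c2) * cosines t 2 + b2 * cosines t 3
  = t * cosines t 2.
Proof.
apply/eqP; rewrite -subr_eq0; apply/eqP.
(* The recurrence holds modulo the quadratic: the two sides differ by [(x * y - t) * f t]. *)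
rewrite -[RHS](mulr0 ((x * y - t))) -ft kR /cosines /f /=; ring.
Qed.
Let h3 : (c 3)%:R * cosines t 2 + ((b 0)%:R - (c 3)%:R) * cosines t 3 = t * cosines t 3.
Proof. by rewrite kR c3R /cosines /=; ring. Qed.

Lemma root_eigenvalue : is_eigenvalue e t.
Proof.
apply: (dist_mx_eigenvalue e_sym e_irr dr h0 h1 h2 h3).
by rewrite /cosines /= gt_eqF // !mulr_gt0.
Qed.

Let r := - (y + b2 + c2 - x) - t.

Lemma cosines_scale :
  c2 * eigen_scale b c (cosines t) t = (x * y - t) * (t + y) * (x - t) * (t - r).
Proof.
rewrite /eigen_scale eigen2E eigen3E ft mulr0 mul0r addr0 /cosines /=.
apply/eqP; rewrite -subr_eq0; apply/eqP.
(* The cofactor is the quotient of the difference of the two sides by [f t]. *)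
rewrite -[RHS](mulr0 (- t ^+ 2 + 2 * x * y * t + x * y * (y - 1 - x))) -ft /r /f; field.
by rewrite gt_eqF.
Qed.

(** [c2 * #|T|] is the value of the quadratic at [x * y], that is [(x * y - t) * (x * y - r)], so
    [x * y - t] cancels. *)
Lemma root_multiplicity : (x * y - t) * (t + y) * (x - t) * (t - r) != 0 ->
  exists m : nat, m%:R * ((t + y) * (x - t) * (t - r))
    = x * y * (x + 1) * (y - 1) * (x * y - r).
Proof.
move=> n0.
have s0 : eigen_scale b c (cosines t) t != 0.
  by apply: contra_neq n0 => s0; rewrite -cosines_scale s0 mulr0.
have [m mE] := dist_mx_multiplicity e_sym e_irr dr h0 h1 h2 h3 s0.
exists m; have tk : x * y - t != 0 by apply: contra_neq n0 => ->; rewrite !mul0r.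
apply: (mulfI tk).
have cn : c2 != 0 by rewrite gt_eqF.
rewrite [LHS](_ : _ = m%:R * ((x * y - t) * (t + y) * (x - t) * (t - r))); last by ring.
rewrite -cosines_scale mulrCA [m%:R * _]mulrC mE (card_verts R e_sym e_irr dr).
rewrite eigen2E eigen3E kR subrr mul0r mul0r addr0 {1}/cosines /=.
apply/eqP; rewrite -subr_eq0; apply/eqP.
rewrite -[RHS](mulr0 (x * y * (x + 1) * (y - 1))) -ft /r /f; field.
by rewrite cn.
Qed.

(** Nonnegativity of the Krein parameter for theta_1, theta_1 and [t]. The standard sequence of
    theta_1 vanishes at distance 2, so three terms remain, with a common positive factor. *)
Lemma root_krein : (x * y - t) * (t + y) * (x - t) * (t - r) > 0 ->
  c2 * (- t - y) <= (y ^+ 2 + t) * b2.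
Proof.
move=> pos.
have s0 : 0 < eigen_scale b c (cosines t) t by rewrite -(pmulr_rgt0 _ c20) cosines_scale.
(* The standard sequence of [theta_1 = x], scaled by [y * b2]. *)
pose u (i : nat) : R := nth 0 [:: y * b2; b2; 0; - c2] i.
have u0 : (b 0)%:R * u 1%N = x * u 0%N by rewrite kR /u /=; ring.
have u1 : u 0%N + ((b 0)%:R - 1 - (b 1)%:R) * u 1%N + (b 1)%:R * u 2 = x * u 1%N.
  by rewrite kR b1R /u /=; ring.
have u2 : c2 * u 1%N + ((b 0)%:R - b2 - c2) * u 2 + b2 * u 3 = x * u 2.
  by rewrite /u /=; ring.
have u3 : (c 3)%:R * u 2 + ((b 0)%:R - (c 3)%:R) * u 3 = x * u 3.
  by rewrite kR c3R /u /=; ring.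
have su : 0 < eigen_scale b c u x.
  rewrite (_ : eigen_scale _ _ _ _ = y * b2 + x * b2 + c2 * (x + 1)).
    by rewrite !addr_gt0 ?mulr_gt0.
  rewrite /eigen_scale eigen2E eigen3E /u /f /=; field.
  by rewrite !gt_eqF.
have := krein e_sym e_irr dr
  (dist_mx_sqr e_sym e_irr dr u0 u1 u2 u3)
  (dist_mx_sqr e_sym e_irr dr h0 h1 h2 h3) su s0.
rewrite kR eigen2E eigen3E subrr mul0r mul0r addr0 /u /cosines /=.
set l := (X in 0 <= X).
rewrite (_ : l = x * y * b2 * (x + 1) * (y - 1) * ((y ^+ 2 + t) * b2 - c2 * (- t - y))).
  rewrite pmulr_rge0 ?subr_ge0 //.
  by rewrite !mulr_gt0.
by rewrite /l; field; rewrite gt_eqF.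
Qed.

End Root.
End Shilla.

(** * Bounds on the smallest eigenvalue *)

Section SmallestEigenvalue.
Variables (R : rcfType) (T : finType) (e : rel T) (b c : nat -> nat) (a g : nat).
Hypotheses (e_sym : symmetric e) (e_irr : irreflexive e).
Hypothesis dr : distance_regular e 3 b c.
Hypotheses (a_gt0 : (0 < a)%N) (g_gt1 : (1 < g)%N).
Hypotheses (b0E : b 0%N = (a * g)%N) (b1E : b 1%N = (a.+1 * g.-1)%N)
  (c3E : c 3%N = (a * g.-1)%N).
Hypothesis g_le_a : (g <= a)%N.

Local Notation x := (@GRing.natmul R (GRing.one R) a).
Local Notation y := (@GRing.natmul R (GRing.one R) g).
Local Notation b2 := (@GRing.natmul R (GRing.one R) (b 2)).
Local Notation c2 := (@GRing.natmul R (GRing.one R) (c 2)).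
Local Notation f := (@shilla_quadratic R b c a g).

(** The claw bound for [m = g]: here [a_1 + 1 = a + 1 - g < a], so [g] closed neighbourhoods cannot
    cover [a * g] points. *)
Lemma shilla_claw : 2 * x + 2 - y ^+ 2 + y <= y * (y + 1) * c2.
Proof.
have b01 : (b 0 - b 1 = a + 1 - g)%N.
  rewrite b0E b1E; case: g g_gt1 g_le_a => // h _ /= ha; rewrite mulSn mulnS; lia.
have lt : (g * (b 0 - b 1) < b 0)%N.
  by rewrite b01 b0E mulnC ltn_pmul2r; lia.
have := claw_bound e_sym e_irr dr lt; rewrite b01 b0E => h.
have c20 := c2_gt0 e_sym dr.
have C2 : ('C(g.+1, 2) * 2 = g.+1 * g)%N by rewrite mulnC -mul_bin_diag bin1.
have : (2 * (g.+1 * (a + 1 - g)) <= 2 * (a * g) + g.+1 * g * (c 2).-1)%N.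
  by rewrite -C2; lia.
rewrite -(ler_nat R) !(natrD, natrM) natrB ?natrD; last by lia.
rewrite -subn1 natrB // -natr1; lra.
Qed.

Lemma quadratic_lt0 : f (- y) < 0.
Proof.
have c20 : 0 < c2 by rewrite ltr0n (c2_gt0 e_sym dr).
have y1 : 0 < y - 1 by rewrite subr_gt0 ltr1n.
rewrite /shilla_quadratic [ltLHS](_ : _ = - ((y - 1) * c2)); last by ring.
by rewrite oppr_lt0 mulr_gt0.
Qed.

(** The quadratic is negative at [- y], which therefore lies strictly between its two real roots. *)
Lemma smallest_root_lt : exists2 t, f t = 0 & t < - y.
Proof.
set p := y + b2 + c2 - x; set q := y * b2 + c2 - x * y.
have fE t : f t = t ^+ 2 + p * t + q by rewrite /shilla_quadratic addrA addrA.
set d := p ^+ 2 - 4 * q.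
have dE : d = (p - 2 * y) ^+ 2 - 4 * f (- y) by rewrite fE /d; ring.
have d0 : (p - 2 * y) ^+ 2 < d by rewrite dE; have := quadratic_lt0; lra.
have dd : Num.sqrt d ^+ 2 = d by rewrite sqr_sqrtr // (le_trans (sqr_ge0 _) (ltW d0)).
exists (- (p + Num.sqrt d) / 2).
  rewrite fE [LHS](_ : _ = (Num.sqrt d ^+ 2 - (p ^+ 2 - 4 * q)) / 4); last by field.
  by rewrite dd subrr mul0r.
have s0 := sqrtr_ge0 d.
suff : 2 * y - p < Num.sqrt d by lra.
rewrite ltNge; apply/negP => le.
have : d <= (p - 2 * y) ^+ 2.
  rewrite -dd -(sqrrN (p - _)) opprB; apply: lerXn2r => //; rewrite nnegrE //.
  exact: le_trans le.
lra.
Qed.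


Lemma no_small_root t : f t = 0 -> (2 < g)%N -> t < - y ^+ 2 + 2 -> False.
Proof.
move=> ft g_gt2 t_lt.
have x0 : 0 < x by rewrite ltr0n.
have y3 : 3 <= y by rewrite (ler_nat R 3).
have yx : y <= x by rewrite ler_nat.
have b20 : 0 < b2 by rewrite ltr0n (b2_gt0 dr).
have c20 : 0 < c2 by rewrite ltr0n (c2_gt0 e_sym dr).
have aI := is_int_nat R a; have gI := is_int_nat R g.
have b2I := is_int_nat R (b 2); have c2I := is_int_nat R (c 2).
have claw := shilla_claw.
pose r := - (y + b2 + c2 - x) - t.
pose s := - t; pose Y := s - y; pose W := r + y.
have [sE rE] : s = - t /\ r = - (y + b2 + c2 - x) - t by [].
have [YE WE] : Y = s - y /\ W = r + y by [].
have Y0 := Y_gt0 sE YE x0 y3 yx b20 c20 t_lt.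
have W0 := W_gt0 sE rE YE WE x0 y3 yx b20 c20 ft t_lt.
have s0 := s_gt0 sE YE x0 y3 yx b20 c20 t_lt.
have rs0 := rs_gt0 sE rE YE WE x0 y3 yx b20 c20 ft t_lt.
have xr0 := xr_gt0 sE rE YE x0 y3 yx b20 c20 ft t_lt.
have xyr0 := xyr_gt0 sE rE YE x0 y3 yx b20 c20 ft t_lt.
have xys0 := xys_gt0 sE YE x0 y3 yx b20 c20 t_lt.
have YWE := YW sE rE YE WE ft.
have b2W := b2_of_W sE rE WE.
have fr : f r = 0 by rewrite /shilla_quadratic (quadratic_factor rE ft) subrr mulr0.
have xs0 : 0 < x + s by rewrite addr_gt0.
have trE : - (y + b2 + c2 - x) - r = t by rewrite /r; ring.
have pos : 0 < (x * y - t) * (t + y) * (x - t) * (t - r).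
  rewrite [ltRHS](_ : _ = (x * y + s) * Y * (x + s) * (r + s)) ?mulr_gt0 //.
  by rewrite /Y /s; ring.
have pos' : 0 < (x * y - r) * (r + y) * (x - r) * (r - (- (y + b2 + c2 - x) - r)).
  by rewrite trE -[r - t]/(r + s) !mulr_gt0.
have kr := root_krein e_sym e_irr dr a_gt0 g_gt1 b0E b1E c3E ft pos.
have krs := krein_s sE rE YE WE x0 y3 yx b20 c20 ft t_lt kr.
have slt := s_lt sE rE YE WE x0 y3 yx b20 c20 ft t_lt kr.
have sgt : y ^+ 2 - 2 < s by rewrite /s; lra.
have [m2 e2] := root_multiplicity e_sym e_irr dr a_gt0 g_gt1 b0E b1E c3E fr
  (lt0r_neq0 pos').
have [m3 e3] := root_multiplicity e_sym e_irr dr a_gt0 g_gt1 b0E b1E c3E ft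
  (lt0r_neq0 pos).
have {}e2 : m2%:R * (W * (x - r) * (r + s)) = x * y * (x + 1) * (y - 1) * (x * y + s).
  by rewrite trE in e2; rewrite -[x * y + s]/(x * y - t) -e2 /W /s; ring.
have {}e3 : m3%:R * (Y * (x + s) * (r + s)) = x * y * (x + 1) * (y - 1) * (x * y - r).
  by rewrite -e3 /Y /s /r; ring.
have [m23|m23] := eqVneq m2 m3.
  have [d [dI d1 Wd dE]] := mults_eq sE rE YE WE x0 y3 yx b20 c20 ft t_lt
    e2 e3 aI gI b2I c2I m23.
  have [d2|d2] := lerP 2 d.
    by apply: (growth_contra y3 x0 sgt slt Wd krs dE d2); left.
  have {dI d1 d2}d1 : d = 1.
    have : 1 <= 2 - d by apply: is_int_ge1; [exact: is_intD (is_int_nat R 2) (is_intN dI)|lra].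
    by move=> ?; apply/eqP; rewrite eq_le; apply/andP; split; lra.
  have [g5|g5] := leqP 5 g.
    apply: (@growth_contra _ _ _ _ _ _ 1 y3 x0 sgt slt Wd krs dE); first by rewrite d1.
    by right; split=> //; rewrite (ler_nat R 5).
  (* With [d = 1], substituting [YW] leaves an equation in [a], [g] and [c 2] alone. *)
  rewrite d1 mul1r -YE YWE in dE.
  have [g3|g4] : g = 3%N \/ g = 4%N by clear -g5 g_gt2; lia.
    apply: (@no_unit_gap3 a (c 2) a_gt0); apply/eqP; rewrite -(eqr_nat R) !(natrM, natrD).
    by rewrite g3 in dE; apply/eqP; lra.
  apply: (@no_unit_gap4 a (c 2) a_gt0); apply/eqP; rewrite -(eqr_nat R) !(natrM, natrD).
  by rewrite g4 in dE; apply/eqP; lra.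
have sy := mults_neq sE rE YE WE x0 y3 yx b20 c20 ft t_lt kr
  e2 e3 aI gI b2I c2I m23.
have WbE : W = x + s - b2 - c2 by rewrite b2W; ring.
have Wint : W = (a%:Z + g%:Z ^+ 2 - 1 - (b 2)%:Z - (c 2)%:Z)%:~R.
  rewrite !(rmorphB, rmorphD, rmorphXn) /= -!pmulrn.
  by rewrite WbE sy; ring.
have WI : is_int W by rewrite Wint; eexists.
have [g4|g4] := leqP 4 g.
  apply: (integral_contra sE rE YE WE x0 y3 yx b20 c20 ft t_lt kr) => //.
  by rewrite (ler_nat R 4).
have g3 : g = 3%N by clear -g4 g_gt2; lia.
(* [w] is [W] as an integer. As [5 * W = 2 * c2], the integer [u] satisfies [W = 2 * u] and
   [c2 = 5 * u]. *)
pose w := (a%:Z + g%:Z ^+ 2 - 1 - (b 2)%:Z - (c 2)%:Z); pose u := (c 2)%:Z - 2 * w.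
have y3E : y = 3 by rewrite g3.
have s8 : s = 8 by rewrite sy y3E; ring.
have YW5 : 5 * W = 2 * c2 by move: YWE; rewrite /Y s8 y3E; lra.
have uR : u%:~R = c2 - 2 * W by rewrite /u rmorphB rmorphM /= -Wint -!pmulrn.
have W2 : W = 2 * u%:~R by rewrite uR; lra.
have rE2 : r = 2 * u%:~R - 3 by rewrite -W2 /W y3E addrK.
have u0 : 0 < u by rewrite -(ltr0z R); lra.
apply: (@no_multiplicities3 a%:Z u m2%:Z m3%:Z u0).
- by rewrite -(ler_int R); move: krs; rewrite s8 y3E W2; lra.
- by rewrite -(ler_int R); move: claw; rewrite y3E; lra.
- apply: (@intr_inj R); have := e2; rewrite rE2 s8 y3E W2 => h.
  transitivity (m2%:R * (2 * u%:~R * (x - (2 * u%:~R - 3)) * (2 * u%:~R - 3 + 8)) : R).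
    by ring.
  by rewrite h; ring.
apply: (@intr_inj R); have := e3; rewrite rE2 YE s8 y3E => h.
transitivity (m3%:R * ((8 - 3) * (x + 8) * (2 * u%:~R - 3 + 8)) : R); first by ring.
by rewrite h; ring.
Qed.

End SmallestEigenvalue.

Unset Implicit Arguments.
Set Strict Implicit.

Theorem theorem20 (R : rcfType) (T : finType) (e : rel T)
    (b c : nat -> nat) (theta3 : R) :
  symmetric e -> irreflexive e ->
  shilla R e b c ->
  smallest_eigenvalue e theta3 ->
  let bG : R := (aparam b c 3)%:R - (aparam b c 1)%:R in
  (theta3 < - bG ^+ 2 + 2) <-> bG = 2.
Proof.
move=> e_sym e_irr sh [ev3 min3] bG.
have [a [g [[a0 g1 b0E b1E c3E] [_ ga gE]]]] := shilla_parameters e_sym e_irr sh.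
have dr : distance_regular e 3 b c by case: sh.
rewrite /bG gE; split=> [lt|g2].
  case: (ltnP 2 g) => [g3|g2]; last by apply/eqP; rewrite eqr_nat eqn_leq g2.
  exfalso; have g3R : 3 <= g%:R :> R by rewrite (ler_nat R 3).
  have a0R : 0 < a%:R :> R by rewrite ltr0n.
  have gg : 0 <= (g%:R - 3 : R) * g%:R by rewrite mulr_ge0 //; lra.
  (* Being negative, [theta3] differs from the eigenvalues [k] and [a_3], so it is a root of the
     quadratic. *)
  have th0 : theta3 < 0 by lra.
  apply: (no_small_root (t := theta3) e_sym e_irr dr a0 g1 b0E b1E c3E ga) => //.
  apply: (eigenvalue_root e_sym e_irr dr a0 g1 b0E b1E c3E) => //.
    by rewrite lt_eqF // (lt_trans th0) // mulr_gt0 // ltr0n ltnW.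
  by rewrite lt_eqF // (lt_trans th0).
(* For [g = 2] the numbers [- g] and [- g ^+ 2 + 2] coincide, so any eigenvalue below [- g]
   suffices. *)
have [t ft tg] := smallest_root_lt R a e_sym dr g1.
apply: (@le_lt_trans _ _ t); last by move: tg; rewrite g2; lra.
exact: min3 (root_eigenvalue e_sym e_irr dr a0 g1 b0E b1E c3E ft).
Qed.
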